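(* Let $\mathcal C$ be a GV-category and $\mathcal M$ a left GV-module category over $\mathcal C$. The relative Serre functors provide an equivalence of categories between the full subcategories $\widehat{\mathcal M}^{\otimes}$ and $\widehat{\mathcal M}^{\odot}$ of $\mathcal M$, i.e. (keeping the symbols $S$ and $\widetilde S$) $$S\colon\widehat{\mathcal M}^{\otimes}\xrightarrow{\ \simeq\ }\widehat{\mathcal M}^{\odot}\qquad\text{and}\qquad\widetilde S\colon\widehat{\mathcal M}^{\odot}\xrightarrow{\ \simeq\ }\widehat{\mathcal M}^{\otimes}.$$ In particular, for every $m\in\widehat{\mathcal M}^{\otimes}$ the object $S(m)$ lies in $\widehat{\mathcal M}^{\odot}$, and $\widetilde S(n)\in\widehat{\mathcal M}^{\otimes}$ for every $n\in\widehat{\mathcal M}^{\odot}$.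
   Context: A GV-category is a monoidal category $(\mathcal C,\otimes,1)$ with a chosen dualizing object $K$: for every $y$ the functor $x\mapsto\mathrm{Hom}(x\otimes y,K)$ is represented by an object $Gy$, and the resulting contravariant functor $G$ is an anti-equivalence. The second tensor product is $x\odot y:=G^{-1}(Gy\otimes Gx)$, with unit $K$. A left GV-module category is a left module category $(\mathcal M,\triangleright)$ over $(\mathcal C,\otimes)$ such that all functors $c\triangleright{-}$ and ${-}\triangleright m$ have right adjoints. Let $c\blacktriangleright{-}$ be a fixed right adjoint of $Gc\triangleright{-}$; $\blacktriangleright$ is an action of $(\mathcal C,\odot)$. Internal Hom and coHom: $\mathrm{Hom}_{\mathcal M}(c\triangleright m,n)\cong\mathrm{Hom}_{\mathcal C}(c,\underline{\mathrm{Hom}}(m,n))$ and $\mathrm{Hom}_{\mathcal M}(n,c\blacktriangleright m)\cong\mathrm{Hom}_{\mathcal C}(\underline{\mathrm{coHom}}(m,n),c)$. $Y_m:=\underline{\mathrm{Hom}}(m,-)\colon\mathcal M\to\mathcal C$ has a lax $\triangleright$-module structure $c\otimes\underline{\mathrm{Hom}}(m,n)\to\underline{\mathrm{Hom}}(m,c\triangleright n)$ (adjunct to the action of $c$ on the evaluation $\underline{\mathrm{Hom}}(m,n)\triangleright m\to n$), and dually $W_m:=\underline{\mathrm{coHom}}(m,-)\colon\mathcal M\to\mathcal C$ has an oplax $\blacktriangleright$-module structure $\underline{\mathrm{coHom}}(m,c\blacktriangleright n)\to c\odot\underline{\mathrm{coHom}}(m,n)$. $\widehat{\mathcal M}^{\otimes}$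 is the full subcategory of objects $m$ for which $Y_m$ is a strong $\triangleright$-module functor and has a right adjoint $Y_m^{\mathrm{r.a.}}$; $\widehat{\mathcal M}^{\odot}$ is the full subcategory of objects $m$ for which $W_m$ is a strong $\blacktriangleright$-module functor and has a left adjoint $W_m^{\mathrm{l.a.}}$. Relative Serre functor $S\colon\widehat{\mathcal M}^{\otimes}\to\mathcal M$: $S(m):=Y_m^{\mathrm{r.a.}}(K)$, so $\mathrm{Hom}_{\mathcal M}(n,S(m))\cong\mathrm{Hom}_{\mathcal C}(\underline{\mathrm{Hom}}(m,n),K)$ naturally; there is an isomorphism of $\triangleright$-module functors $\underline{\mathrm{Hom}}(m,-)\cong\underline{\mathrm{coHom}}(S(m),-)$, and $S(m)$ is unique up to unique isomorphism with this property, which determines $S$ on morphisms. Inverse relative Serre functor $\widetilde S\colon\widehat{\mathcal M}^{\odot}\to\mathcal M$: $\widetilde S(m):=W_m^{\mathrm{l.a.}}(1)$, with an isomorphism of $\blacktriangleright$-module functors $\underline{\mathrm{coHom}}(m,-)\cong\underline{\mathrm{Hom}}(\widetilde S(m),-)$. *)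

(* Defs.v *)
From Corelib Require Import ssreflect.

Set Implicit Arguments.
Unset Strict Implicit.
Unset Printing Implicit Defensive.
Set Primitive Projections.

Declare Scope cat_scope.
Delimit Scope cat_scope with cat.
Local Open Scope cat_scope.

Record Category := {
  ob :> Type;
  hom : ob -> ob -> Type;
  idm : forall x, hom x x;
  comp : forall x y z, hom y z -> hom x y -> hom x z;
  comp1m : forall x y (f : hom x y), comp (idm y) f = f;
  compm1 : forall x y (f : hom x y), comp f (idm x) = f;
  compA : forall w x y z (h : hom y z) (g : hom x y) (f : hom w x),
      comp h (comp g f) = comp (comp h g) f
}.
Arguments hom {c} x y.
Arguments idm {c} x.
Arguments comp {c x y z} g f : rename.
Notation "g ∘ f" := (comp g f) (at level 40, left associativity) : cat_scope.

Definition is_iso (C : Category) (x y : C) (f : hom x y) : Prop :=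
  exists g : hom y x, g ∘ f = idm x /\ f ∘ g = idm y.

Definition op (C : Category) : Category := {|
  ob := ob C;
  hom := fun x y => @hom C y x;
  idm := fun x => @idm C x;
  comp := fun x y z g f => @comp C z y x f g;
  comp1m := fun x y f => @compm1 C y x f;
  compm1 := fun x y f => @comp1m C y x f;
  compA := fun w x y z h g f => eq_sym (@compA C z y x w f g h)
|}.

Definition prodC (A B : Category) : Category.
Proof.
refine {|
  ob := (ob A * ob B)%type;
  hom := fun x y => (hom (fst x) (fst y) * hom (snd x) (snd y))%type;
  idm := fun x => (idm (fst x), idm (snd x));
  comp := fun x y z g f => (fst g ∘ fst f, snd g ∘ snd f)
|}.
- by move=> x y [f g] /=; rewrite !comp1m.
- by move=> x y [f g] /=; rewrite !compm1.
- by move=> w x y z h g f /=; rewrite !compA.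
Defined.

Definition full_sub (C : Category) (P : C -> Prop) : Category := {|
  ob := {x : C | P x};
  hom := fun x y => @hom C (proj1_sig x) (proj1_sig y);
  idm := fun x => idm (proj1_sig x);
  comp := fun x y z g f => g ∘ f;
  comp1m := fun x y f => comp1m f;
  compm1 := fun x y f => compm1 f;
  compA := fun w x y z h g f => compA h g f
|}.

Record Functor (C D : Category) := {
  fobj :> C -> D;
  fmap : forall x y, hom x y -> hom (fobj x) (fobj y);
  fmap1 : forall x, fmap (idm x) = idm (fobj x);
  fmapM : forall x y z (g : hom y z) (f : hom x y),
      fmap (g ∘ f) = fmap g ∘ fmap f
}.
Arguments fmap {C D} F {x y} f : rename.

Definition idF (C : Category) : Functor C C := {|
  fobj := fun x => x;
  fmap := fun x y f => f;
  fmap1 := fun x => eq_refl;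
  fmapM := fun x y z g f => eq_refl
|}.

Definition compF (A B C : Category) (G : Functor B C) (F : Functor A B) :
  Functor A C.
Proof.
refine {| fobj := fun x => G (F x); fmap := fun x y f => fmap G (fmap F f) |}.
- by move=> x; rewrite !fmap1.
- by move=> x y z g f; rewrite !fmapM.
Defined.

Definition corestrict (A C : Category) (P : C -> Prop) (F : Functor A C)
    (HF : forall a, P (F a)) : Functor A (full_sub P) := {|
  fobj := fun a => (exist P (F a) (HF a) : full_sub P);
  fmap := fun x y f => fmap F f;
  fmap1 := fun x => fmap1 F x;
  fmapM := fun x y z g f => fmapM F g f
|}.

Record NatIso (C D : Category) (F G : Functor C D) := {
  ni_fwd : forall x, hom (F x) (G x);
  ni_bwd : forall x, hom (G x) (F x);
  ni_fwdK : forall x, ni_bwd x ∘ ni_fwd x = idm (F x);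
  ni_bwdK : forall x, ni_fwd x ∘ ni_bwd x = idm (G x);
  ni_nat : forall x y (f : hom x y), ni_fwd y ∘ fmap F f = fmap G f ∘ ni_fwd x
}.

Record QuasiInverse (C D : Category) (F : Functor C D) := {
  qi :> Functor D C;
  qi_unit : NatIso (compF qi F) (idF C);
  qi_counit : NatIso (compF F qi) (idF D)
}.

Definition is_equivalence (C D : Category) (F : Functor C D) : Prop :=
  inhabited (QuasiInverse F).

Definition quasi_inverse_pair (C D : Category) (F : Functor C D)
    (G : Functor D C) : Prop :=
  inhabited (NatIso (compF G F) (idF C)) /\
  inhabited (NatIso (compF F G) (idF D)).

Record Adjunction (C D : Category) (L : Functor C D) (R : Functor D C) := {
  adjr : forall x y, hom (L x) y -> hom x (R y);
  adjl : forall x y, hom x (R y) -> hom (L x) y;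
  adjrK : forall x y (f : hom (L x) y), adjl (adjr f) = f;
  adjlK : forall x y (g : hom x (R y)), adjr (adjl g) = g;
  adjr_natl : forall x x' y (f : hom (L x) y) (g : hom x' x),
      adjr (f ∘ fmap L g) = adjr f ∘ g;
  adjr_natr : forall x y y' (h : hom y y') (f : hom (L x) y),
      adjr (h ∘ f) = fmap R h ∘ adjr f
}.

Record RightAdjoint (C D : Category) (L : Functor C D) := {
  ra_fun :> Functor D C;
  ra_adj : Adjunction L ra_fun
}.

Record LeftAdjoint (C D : Category) (R : Functor D C) := {
  la_fun :> Functor C D;
  la_adj : Adjunction la_fun R
}.

Definition counit (C D : Category) (L : Functor C D) (R : RightAdjoint L)
    (y : D) : hom (L (R y)) y := adjl (ra_adj R) (idm (R y)).
Definition unit (C D : Category) (R : Functor D C) (L : LeftAdjoint R)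
    (x : C) : hom x (R (L x)) := adjr (la_adj L) (idm (L x)).
Arguments counit {C D L} R y.
Arguments unit {C D R} L x.

Lemma counitE (A B : Category) (L : Functor A B) (R : RightAdjoint L)
    (x : A) (y : B) (g : hom x (R y)) :
  adjl (ra_adj R) g = counit R y ∘ fmap L g.
Proof. by rewrite -[RHS](adjrK (ra_adj R)) adjr_natl adjlK comp1m. Qed.

Lemma counit_adjr (A B : Category) (L : Functor A B) (R : RightAdjoint L)
    (x : A) (y : B) (f : hom (L x) y) :
  counit R y ∘ fmap L (adjr (ra_adj R) f) = f.
Proof. by rewrite -counitE adjrK. Qed.

Lemma counit_inj (A B : Category) (L : Functor A B) (R : RightAdjoint L)
    (x : A) (y : B) (g g' : hom x (R y)) :
  counit R y ∘ fmap L g = counit R y ∘ fmap L g' -> g = g'.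
Proof. by rewrite -!counitE => E; rewrite -(adjlK (ra_adj R) g) E adjlK. Qed.

Lemma counit_nat (A B : Category) (L : Functor A B) (R : RightAdjoint L)
    (y y' : B) (h : hom y y') :
  counit R y' ∘ fmap L (fmap R h) = h ∘ counit R y.
Proof.
rewrite -counitE -[RHS](adjrK (ra_adj R)); congr adjl.
by rewrite adjr_natr adjlK compm1.
Qed.

Lemma unitE (A B : Category) (R : Functor B A) (L : LeftAdjoint R)
    (x : A) (y : B) (f : hom (L x) y) :
  adjr (la_adj L) f = fmap R f ∘ unit L x.
Proof. by rewrite -adjr_natr compm1. Qed.

Lemma unit_adjl (A B : Category) (R : Functor B A) (L : LeftAdjoint R)
    (x : A) (y : B) (g : hom x (R y)) :
  fmap R (adjl (la_adj L) g) ∘ unit L x = g.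
Proof. by rewrite -unitE adjlK. Qed.

Lemma unit_inj (A B : Category) (R : Functor B A) (L : LeftAdjoint R)
    (x : A) (y : B) (f f' : hom (L x) y) :
  fmap R f ∘ unit L x = fmap R f' ∘ unit L x -> f = f'.
Proof. by rewrite -!unitE => E; rewrite -(adjrK (la_adj L) f) E adjrK. Qed.

Lemma unit_nat (A B : Category) (R : Functor B A) (L : LeftAdjoint R)
    (x x' : A) (g : hom x x') :
  fmap R (fmap L g) ∘ unit L x = unit L x' ∘ g.
Proof. by rewrite -unitE -[fmap L g]comp1m adjr_natl. Qed.

Lemma left_adjoint_of_repr (A B : Category) (R : Functor B A) (L : A -> B)
    (p : forall x y, hom (L x) y -> hom x (R y))
    (q : forall x y, hom x (R y) -> hom (L x) y) :
  (forall x y (f : hom (L x) y), q x y (p x y f) = f) ->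
  (forall x y (g : hom x (R y)), p x y (q x y g) = g) ->
  (forall x y y' (h : hom y y') (f : hom (L x) y),
      p x y' (h ∘ f) = fmap R h ∘ p x y f) ->
  LeftAdjoint R.
Proof.
move=> pK qK pN.
have pE x y f : p x y f = fmap R f ∘ p x (L x) (idm _) by rewrite -pN compm1.
have inj x y f f' : p x y f = p x y f' -> f = f'.
  by move=> E; rewrite -(pK _ _ f) E pK.
unshelve refine (let LF : Functor A B := {| fobj := L;
  fmap := fun x y g => q x (L y) (p y (L y) (idm (L y)) ∘ g) |} in _).
- by move=> x; rewrite compm1 pK.
- by move=> x y z g f; apply: (inj); rewrite pN !qK !compA -pE qK.
- unshelve refine {| la_fun := LF; la_adj := {| adjr := p : forall x y,
    hom (LF x) y -> hom x (R y); adjl := q |} |} => //=.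
  by move=> x x' y f g; rewrite pN qK compA -pE.
Qed.

Section QuasiInverseTheory.
Variables (C D : Category) (F : Functor C D) (Q : QuasiInverse F).

Lemma qi_faithful (x y : D) (k k' : hom x y) :
  fmap Q k = fmap Q k' -> k = k'.
Proof.
move=> E; rewrite -[k]compm1 -[k']compm1 -!(ni_bwdK (qi_counit Q) x) !compA.
by rewrite -!(ni_nat (qi_counit Q)) /= E.
Qed.

Definition qi_preimage (x y : C) (k : hom (F x) (F y)) : hom x y :=
  ni_fwd (qi_unit Q) y ∘ fmap Q k ∘ ni_bwd (qi_unit Q) x.

Lemma qi_preimageK (x y : C) (f : hom x y) : qi_preimage (fmap F f) = f.
Proof.
rewrite /qi_preimage (ni_nat (qi_unit Q) f) -compA.
by rewrite (ni_bwdK (qi_unit Q)) compm1.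
Qed.

Lemma fmap_qi_preimage (x y : C) (k : hom (F x) (F y)) :
  fmap F (qi_preimage k) = k.
Proof.
apply: qi_faithful; set f := qi_preimage k.
rewrite -[LHS]comp1m -(ni_fwdK (qi_unit Q)) -compA (ni_nat (qi_unit Q) f) /=.
by rewrite /f /qi_preimage -!compA (ni_fwdK (qi_unit Q)) compm1 compA
           (ni_fwdK (qi_unit Q)) comp1m.
Qed.

End QuasiInverseTheory.

Definition bimap (A B C : Category) (F : Functor (prodC A B) C)
    (a a' : A) (b b' : B) (f : hom a a') (g : hom b b') :
  hom (F (a, b)) (F (a', b')) :=
  @fmap (prodC A B) C F (a, b) (a', b') (f, g).

Lemma bimap1 (A B C : Category) (F : Functor (prodC A B) C) (a : A) (b : B) :
  bimap F (idm a) (idm b) = idm (F (a, b)).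
Proof. exact: (fmap1 F ((a, b) : prodC A B)). Qed.

Lemma bimapM (A B C : Category) (F : Functor (prodC A B) C)
    (a a' a'' : A) (b b' b'' : B) (f' : hom a' a'') (f : hom a a')
    (g' : hom b' b'') (g : hom b b') :
  bimap F f' g' ∘ bimap F f g = bimap F (f' ∘ f) (g' ∘ g).
Proof.
by rewrite /bimap -(@fmapM (prodC A B) C F (a, b) (a', b') (a'', b'')).
Qed.

Lemma bimapMl (A B C : Category) (F : Functor (prodC A B) C)
    (a a' a'' : A) (b : B) (f' : hom a' a'') (f : hom a a') :
  bimap F (f' ∘ f) (idm b) = bimap F f' (idm b) ∘ bimap F f (idm b).
Proof. by rewrite bimapM comp1m. Qed.

Lemma bimapMr (A B C : Category) (F : Functor (prodC A B) C)
    (a : A) (b b' b'' : B) (g' : hom b' b'') (g : hom b b') :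
  bimap F (idm a) (g' ∘ g) = bimap F (idm a) g' ∘ bimap F (idm a) g.
Proof. by rewrite bimapM comp1m. Qed.

Lemma bimap_swap (A B C : Category) (F : Functor (prodC A B) C)
    (a a' : A) (b b' : B) (f : hom a a') (g : hom b b') :
  bimap F f (idm b') ∘ bimap F (idm a) g =
  bimap F (idm a') g ∘ bimap F f (idm b).
Proof. by rewrite !bimapM !comp1m !compm1. Qed.

Definition fix_l (A B C : Category) (F : Functor (prodC A B) C) (a : A) :
  Functor B C.
Proof.
refine {| fobj := fun b => F (a, b); fmap := fun b b' g => bimap F (idm a) g |}.
- by move=> b; exact: bimap1.
- by move=> x y z g f; exact: bimapMr.
Defined.

Definition fix_r (A B C : Category) (F : Functor (prodC A B) C) (b : B) :
  Functor A C.
Proof.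
refine {| fobj := fun a => F (a, b); fmap := fun a a' f => bimap F f (idm b) |}.
- by move=> a; exact: bimap1.
- by move=> x y z g f; exact: bimapMl.
Defined.

Record MonoidalCategory := {
  mon_cat :> Category;
  tens : Functor (prodC mon_cat mon_cat) mon_cat;
  one : mon_cat;
  massoc : forall x y z : mon_cat,
      hom (tens (tens (x, y), z)) (tens (x, tens (y, z)));
  mlunit : forall x : mon_cat, hom (tens (one, x)) x;
  mrunit : forall x : mon_cat, hom (tens (x, one)) x;
  massoc_iso : forall x y z, is_iso (massoc x y z);
  mlunit_iso : forall x, is_iso (mlunit x);
  mrunit_iso : forall x, is_iso (mrunit x);
  massoc_nat : forall x x' y y' z z'
      (f : hom x x') (g : hom y y') (h : hom z z'),
      massoc x' y' z' ∘ bimap tens (bimap tens f g) h =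
      bimap tens f (bimap tens g h) ∘ massoc x y z;
  mlunit_nat : forall x y (f : hom x y),
      mlunit y ∘ bimap tens (idm one) f = f ∘ mlunit x;
  mrunit_nat : forall x y (f : hom x y),
      mrunit y ∘ bimap tens f (idm one) = f ∘ mrunit x;
  mpentagon : forall w x y z,
      massoc w x (tens (y, z)) ∘ massoc (tens (w, x)) y z =
      bimap tens (idm w) (massoc x y z) ∘ massoc w (tens (x, y)) z
        ∘ bimap tens (massoc w x y) (idm z);
  mtriangle : forall x y,
      bimap tens (idm x) (mlunit y) ∘ massoc x one y =
      bimap tens (mrunit x) (idm y)
}.
Arguments one {m}.
Notation "x ⊗ y" := (fobj (tens _) (x, y))
  (at level 38, left associativity) : cat_scope.
Notation "f ⊗m g" := (bimap (tens _) f g)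
  (at level 38, left associativity) : cat_scope.

(* An object K such that every presheaf Hom(- ⊗ y, K) is represented by a
   chosen object [dual_ob y]. *)
Record Duality (C : MonoidalCategory) := {
  KK : C;
  dual_ob : C -> C;
  dual_r : forall x y : C, hom (x ⊗ y) KK -> hom x (dual_ob y);
  dual_l : forall x y : C, hom x (dual_ob y) -> hom (x ⊗ y) KK;
  dual_rK : forall x y (f : hom (x ⊗ y) KK), dual_l (dual_r f) = f;
  dual_lK : forall x y (g : hom x (dual_ob y)), dual_r (dual_l g) = g;
  dual_nat : forall x x' y (f : hom (x ⊗ y) KK) (g : hom x' x),
      dual_r (f ∘ (g ⊗m idm y)) = dual_r f ∘ g
}.

Section DualFunctor.
Variables (C : MonoidalCategory) (D : Duality C).

Definition dual_ev (y : C) : hom (dual_ob D y ⊗ y) (KK D) :=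
  dual_l (idm (dual_ob D y)).

Definition dual_map (y y' : C) (f : hom y y') :
  hom (dual_ob D y') (dual_ob D y) :=
  dual_r (dual_ev y' ∘ (idm (dual_ob D y') ⊗m f)).

Lemma dual_lE (x y : C) (g : hom x (dual_ob D y)) :
  dual_l g = dual_ev y ∘ (g ⊗m idm y).
Proof. by rewrite -[RHS]dual_rK dual_nat dual_lK comp1m. Qed.

Lemma dual_map_ev (y y' : C) (f : hom y y') :
  dual_ev y ∘ (dual_map f ⊗m idm y) = dual_ev y' ∘ (idm _ ⊗m f).
Proof. by rewrite -dual_lE dual_rK. Qed.

Lemma dual_mapM (x y z : C) (f : hom x y) (g : hom y z) :
  dual_map (g ∘ f) = dual_map f ∘ dual_map g.
Proof.
rewrite -[RHS]dual_lK; congr dual_r.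
rewrite dual_lE bimapMl compA dual_map_ev -compA -bimap_swap.
by rewrite bimapMr !compA dual_map_ev.
Qed.

Definition dualF : Functor (op C) C.
Proof.
refine {| fobj := (dual_ob D : op C -> C);
          fmap := fun x y f => @dual_map y x f |}.
- by move=> x; rewrite /dual_map bimap1 compm1 dual_lK.
- by move=> x y z g f; exact: dual_mapM.
Defined.

End DualFunctor.

Record GVCategory := {
  gv_mon :> MonoidalCategory;
  gv_dual : Duality gv_mon;
  gv_dual_inv : QuasiInverse (dualF gv_dual)
}.

Definition K (C : GVCategory) : C := KK (gv_dual C).
Definition G (C : GVCategory) : Functor (op C) C := dualF (gv_dual C).
Definition Ginv (C : GVCategory) : Functor C (op C) := gv_dual_inv C.
Definition Gcounit (C : GVCategory) (x : C) : hom (G C (Ginv C x)) x :=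
  ni_fwd (qi_counit (gv_dual_inv C)) x.
Definition odot (C : GVCategory) (x y : C) : C := Ginv C (G C y ⊗ G C x).
Arguments K {C}.
Arguments G {C}.
Arguments Ginv {C}.
Notation "x ⊙ y" := (odot x y) (at level 38, left associativity) : cat_scope.

Record ModuleCategory (C : MonoidalCategory) := {
  mod_cat :> Category;
  act : Functor (prodC C mod_cat) mod_cat;
  aassoc : forall (c d : C) (m : mod_cat),
      hom (act (c ⊗ d, m)) (act (c, act (d, m)));
  aunit : forall m : mod_cat, hom (act (one, m)) m;
  aassoc_iso : forall c d m, is_iso (aassoc c d m);
  aunit_iso : forall m, is_iso (aunit m);
  aassoc_nat : forall (c c' d d' : C) (m m' : mod_cat)
      (f : hom c c') (g : hom d d') (h : hom m m'),
      aassoc c' d' m' ∘ bimap act (f ⊗m g) h =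
      bimap act f (bimap act g h) ∘ aassoc c d m;
  aunit_nat : forall (m m' : mod_cat) (f : hom m m'),
      aunit m' ∘ bimap act (idm one) f = f ∘ aunit m;
  apentagon : forall (b c d : C) (m : mod_cat),
      aassoc b c (act (d, m)) ∘ aassoc (b ⊗ c) d m =
      bimap act (idm b) (aassoc c d m) ∘ aassoc b (c ⊗ d) m
        ∘ bimap act (massoc b c d) (idm m);
  atriangle : forall (c : C) (m : mod_cat),
      bimap act (idm c) (aunit m) ∘ aassoc c one m =
      bimap act (mrunit c) (idm m)
}.
Notation "c ▷ m" := (fobj (act _) (c, m))
  (at level 39, right associativity) : cat_scope.
Notation "f ▷m g" := (bimap (act _) f g)
  (at level 39, right associativity) : cat_scope.

Definition act_l (C : MonoidalCategory) (M : ModuleCategory C) (c : C) :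
  Functor M M := fix_l (act M) c.
Definition act_r (C : MonoidalCategory) (M : ModuleCategory C) (m : M) :
  Functor C M := fix_r (act M) m.

(* The existence of a right adjoint of every c ▷ - is recorded separately from
   the fixed right adjoints of the functors G c ▷ -.  [ihom m] is the fixed
   internal Hom functor of m. *)
Record GVModuleCategory (C : GVCategory) := {
  gvm_mod :> ModuleCategory C;
  gvm_act_ra : forall c : C, inhabited (RightAdjoint (act_l gvm_mod c));
  coact : forall c : C, RightAdjoint (act_l gvm_mod (G c));
  ihom : forall m : gvm_mod, RightAdjoint (act_r m)
}.
Arguments coact {C g} c.
Arguments ihom {C g} m.
Notation "c ▶ m" := (fobj (ra_fun (coact c)) m)
  (at level 39, right associativity) : cat_scope.

Section Coaction.
Variables (C : GVCategory) (M : GVModuleCategory C).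

(* The mate of G f ▷ - : G c' ▷ - => G c ▷ - for f : c -> c'. *)
Definition coact_map (c c' : C) (f : hom c c') (m : M) : hom (c ▶ m) (c' ▶ m) :=
  adjr (ra_adj (coact c'))
    (counit (coact c) m ∘ (@fmap (op C) C G c' c f ▷m idm (c ▶ m))).

Lemma coact_map_counit (c c' : C) (f : hom c c') (m : M) :
  counit (coact c') m ∘ (idm (G c') ▷m coact_map f m) =
  counit (coact c) m ∘ (@fmap (op C) C G c' c f ▷m idm (c ▶ m)).
Proof. by rewrite -[LHS](counitE (R := coact c')) adjrK. Qed.

Lemma coact_mapM (x y z : C) (f : hom x y) (g : hom y z) (m : M) :
  coact_map (g ∘ f) m = coact_map g m ∘ coact_map f m.
Proof.
rewrite -[RHS](adjlK (ra_adj (coact z))); congr adjr.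
rewrite counitE /= bimapMr compA coact_map_counit -compA bimap_swap compA.
by rewrite coact_map_counit -compA -bimapMl -(@fmapM (op C) C G z y x f g).
Qed.

Definition coact_r (m : M) : Functor C M.
Proof.
refine {| fobj := fun c : C => c ▶ m;
          fmap := fun c c' f => coact_map f m |}.
- move=> c; rewrite /coact_map (@fmap1 (op C) C G c) bimap1 compm1.
  by rewrite adjlK.
- by move=> x y z g f; exact: coact_mapM.
Defined.

Lemma coact_map_nat (c c' : C) (h : hom c c') (m m' : M) (f : hom m m') :
  coact_map h m' ∘ fmap (coact c) f = fmap (coact c') f ∘ coact_map h m.
Proof.
apply: counit_inj.
rewrite !fmapM !compA [in RHS]counit_nat -[in RHS]compA.
rewrite [in LHS]coact_map_counit [in RHS]coact_map_counit -compA bimap_swap.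
by rewrite compA (counit_nat (coact c) f) compA.
Qed.

Lemma coact_map_adjr (c c' : C) (h : hom c c') (n m : M)
    (k : hom (G c ▷ n) m) :
  adjr (ra_adj (coact c')) (k ∘ (@fmap (op C) C G c' c h ▷m idm n)) =
  coact_map h m ∘ adjr (ra_adj (coact c)) k.
Proof.
apply: counit_inj; rewrite counit_adjr fmapM compA coact_map_counit -compA.
by rewrite bimap_swap compA (counit_adjr (coact c)).
Qed.

(* The comparison of ▶ with ⊙: under the adjunctions defining ▶ it is the
   mate of G (c ⊙ d) ▷ - ≅ (G d ⊗ G c) ▷ - ≅ G d ▷ (G c ▷ -). *)
Definition coact_assoc (c d : C) (m : M) : hom (c ▶ d ▶ m) ((c ⊙ d) ▶ m) :=
  adjr (ra_adj (coact (c ⊙ d)))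
    (counit (coact d) m
       ∘ (idm (G d) ▷m counit (coact c) (d ▶ m))
       ∘ aassoc (G d) (G c) (c ▶ d ▶ m)
       ∘ (Gcounit (G d ⊗ G c) ▷m idm (c ▶ d ▶ m))).

Definition ihom_ev (m n : M) : hom (ihom m n ▷ m) n := counit (ihom m) n.

(* The transformation Hom(f, -) : Hom(m', -) => Hom(m, -). *)
Definition ihom_pre (m m' : M) (f : hom m m') (n : M) :
  hom (ihom m' n) (ihom m n) :=
  adjr (ra_adj (ihom m)) (ihom_ev m' n ∘ (idm (ihom m' n) ▷m f)).

Lemma ihom_pre_ev (m m' : M) (f : hom m m') (n : M) :
  ihom_ev m n ∘ (ihom_pre f n ▷m idm m) =
  ihom_ev m' n ∘ (idm (ihom m' n) ▷m f).
Proof. exact: (counit_adjr (ihom m)). Qed.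

Lemma ihom_pre1 (m n : M) : ihom_pre (idm m) n = idm (ihom m n).
Proof. by rewrite /ihom_pre bimap1 compm1 adjlK. Qed.

Lemma ihom_preM (m m' m'' : M) (f : hom m m') (g : hom m' m'') (n : M) :
  ihom_pre (g ∘ f) n = ihom_pre f n ∘ ihom_pre g n.
Proof.
apply: counit_inj; rewrite /= bimapMl compA !ihom_pre_ev -compA -bimap_swap.
by rewrite bimapMr !compA ihom_pre_ev.
Qed.

Lemma ihom_pre_nat (m m' : M) (f : hom m m') (n n' : M) (h : hom n n') :
  ihom_pre f n' ∘ fmap (ihom m') h = fmap (ihom m) h ∘ ihom_pre f n.
Proof.
apply: counit_inj; rewrite /= !bimapMl !compA ihom_pre_ev -compA -bimap_swap.
rewrite compA (counit_nat (ihom m') h) (counit_nat (ihom m) h) -!compA.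
by rewrite ihom_pre_ev.
Qed.

Definition ihom_lax (m : M) (c : C) (n : M) :
  hom (c ⊗ ihom m n) (ihom m (c ▷ n)) :=
  adjr (ra_adj (ihom m))
    ((idm c ▷m ihom_ev m n) ∘ aassoc c (ihom m n) m).

(* The coherence axioms of a module functor hold for the canonical lax
   structure, so strength amounts to invertibility of its components. *)
Definition ihom_strong (m : M) : Prop :=
  forall (c : C) (n : M), is_iso (ihom_lax m c n).

Definition hat_otimes (m : M) : Prop :=
  ihom_strong m /\ inhabited (RightAdjoint (ihom m)).

(* The left adjoints defining coHom always exist. *)
Lemma icohom_exists (m : M) : inhabited (LeftAdjoint (coact_r m)).
Proof.
pose Q := gv_dual_inv C; pose e := qi_counit Q.
constructor.
apply: (@left_adjoint_of_repr _ _ (coact_r m) (fun n => Ginv (ihom n m))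
  (fun n c f => adjr (ra_adj (coact c))
     (adjl (ra_adj (ihom n))
       (ni_fwd e (ihom n m) ∘ @fmap (op C) C G c (Ginv (ihom n m)) f)))
  (fun n c g => @qi_preimage (op C) C G Q c (Ginv (ihom n m))
     (ni_bwd e (ihom n m) ∘
        adjr (ra_adj (ihom n)) (adjl (ra_adj (coact c)) g)))).
- move=> n c f.
  by rewrite !adjrK !adjlK !compA (ni_fwdK e) comp1m qi_preimageK.
- move=> n c g.
  by rewrite fmap_qi_preimage !compA (ni_bwdK e) comp1m !adjrK !adjlK.
- move=> n c c' h f.
  rewrite (@fmapM (op C) C G c' c (Ginv (ihom n m)) f h) compA.
  by rewrite counitE /= bimapMl compA -(coact_map_adjr h) counitE.
Qed.

(* [W m] is the internal coHom functor of m. *)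
Variable W : forall m : M, LeftAdjoint (coact_r m).

Definition icohom_coev (m n : M) : hom n (W m n ▶ m) := unit (W m) n.

Definition icohom_pre (m m' : M) (f : hom m m') (n : M) :
  hom (W m' n) (W m n) :=
  adjl (la_adj (W m')) (fmap (coact (W m n)) f ∘ icohom_coev m n).

Lemma icohom_pre_coev (m m' : M) (f : hom m m') (n : M) :
  coact_map (icohom_pre f n) m' ∘ icohom_coev m' n =
  fmap (coact (W m n)) f ∘ icohom_coev m n.
Proof. exact: (unit_adjl (W m')). Qed.

Lemma icohom_pre1 (m n : M) : icohom_pre (idm m) n = idm (W m n).
Proof. by rewrite /icohom_pre fmap1 comp1m adjrK. Qed.

Lemma icohom_preM (m m' m'' : M) (f : hom m m') (g : hom m' m'') (n : M) :
  icohom_pre (g ∘ f) n = icohom_pre f n ∘ icohom_pre g n.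
Proof.
apply: (unit_inj (L := W m'')); rewrite (fmapM (coact_r m'')) -compA.
rewrite !icohom_pre_coev compA coact_map_nat -compA icohom_pre_coev compA.
by rewrite fmapM.
Qed.

Lemma icohom_pre_nat (m m' : M) (f : hom m m') (n n' : M) (h : hom n n') :
  icohom_pre f n' ∘ fmap (W m') h = fmap (W m) h ∘ icohom_pre f n.
Proof.
apply: (unit_inj (L := W m')); rewrite !(fmapM (coact_r m')) -!compA.
rewrite icohom_pre_coev (unit_nat (W m') h) compA icohom_pre_coev -compA.
by rewrite -(unit_nat (W m) h) !compA coact_map_nat.
Qed.

Definition icohom_oplax (m : M) (c : C) (n : M) :
  hom (W m (c ▶ n)) (c ⊙ W m n) :=
  adjl (la_adj (W m))
    (coact_assoc c (W m n) m ∘ fmap (coact c) (icohom_coev m n)).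

Definition icohom_strong (m : M) : Prop :=
  forall (c : C) (n : M), is_iso (icohom_oplax m c n).

Definition hat_odot (m : M) : Prop :=
  icohom_strong m /\ inhabited (LeftAdjoint (W m)).

End Coaction.

Definition Mhat_otimes (C : GVCategory) (M : GVModuleCategory C) : Category :=
  full_sub (@hat_otimes C M).
Definition Mhat_odot (C : GVCategory) (M : GVModuleCategory C)
    (W : forall m : M, LeftAdjoint (coact_r m)) : Category :=
  full_sub (hat_odot W).

Section Serre.
Variables (C : GVCategory) (M : GVModuleCategory C).
Variable Yra : forall m : Mhat_otimes M, RightAdjoint (ihom (proj1_sig m)).

Definition serre_ob (m : Mhat_otimes M) : M := Yra m K.

(* On morphisms: the K-component of the mate of Hom(f, -), i.e. the unique map
   making Hom(n, S m) ≅ Hom(Hom(m, n), K) natural in m. *)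
Definition serre_map (m m' : Mhat_otimes M) (f : hom m m') :
  hom (serre_ob m) (serre_ob m') :=
  adjr (ra_adj (Yra m')) (counit (Yra m) K ∘ ihom_pre f (serre_ob m)).

Lemma serre_map_counit (m m' : Mhat_otimes M) (f : hom m m') :
  counit (Yra m') K ∘ fmap (ihom (proj1_sig m')) (serre_map f) =
  counit (Yra m) K ∘ ihom_pre f (serre_ob m).
Proof. exact: (counit_adjr (Yra m')). Qed.

Definition serre : Functor (Mhat_otimes M) M.
Proof.
refine {| fobj := serre_ob; fmap := serre_map |}.
- move=> m; apply: (counit_inj (R := Yra m)).
  by rewrite serre_map_counit ihom_pre1 fmap1.
- move=> m m' m'' g f; apply: (counit_inj (R := Yra m'')).
  rewrite fmapM compA !serre_map_counit -compA ihom_pre_nat compA.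
  by rewrite serre_map_counit -compA -ihom_preM.
Defined.

Variable W : forall m : M, LeftAdjoint (coact_r m).
Variable Wla : forall m : Mhat_odot W, LeftAdjoint (W (proj1_sig m)).

Definition inv_serre_ob (m : Mhat_odot W) : M := Wla m one.

Definition inv_serre_map (m m' : Mhat_odot W) (f : hom m m') :
  hom (inv_serre_ob m) (inv_serre_ob m') :=
  adjl (la_adj (Wla m)) (icohom_pre W f (inv_serre_ob m') ∘ unit (Wla m') one).

Lemma inv_serre_map_unit (m m' : Mhat_odot W) (f : hom m m') :
  fmap (W (proj1_sig m)) (inv_serre_map f) ∘ unit (Wla m) one =
  icohom_pre W f (inv_serre_ob m') ∘ unit (Wla m') one.
Proof. exact: (unit_adjl (Wla m)). Qed.

Definition inv_serre : Functor (Mhat_odot W) M.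
Proof.
refine {| fobj := inv_serre_ob; fmap := inv_serre_map |}.
- move=> m; apply: (unit_inj (L := Wla m)).
  by rewrite inv_serre_map_unit icohom_pre1 fmap1.
- move=> m m' m'' g f; apply: (unit_inj (L := Wla m)).
  rewrite fmapM -compA !inv_serre_map_unit compA -icohom_pre_nat -compA.
  by rewrite inv_serre_map_unit compA -icohom_preM.
Defined.

End Serre.

Arguments serre {C M} Yra.
Arguments inv_serre {C M W} Wla.

(* Main.v *)
From Corelib Require Import ssreflect ssrfun.
From Stdlib Require Import IndefiniteDescription.
Require Import Defs.

Set Implicit Arguments.
Unset Strict Implicit.
Unset Printing Implicit Defensive.
Local Open Scope cat_scope.

(** Write [m, s] for the internal Hom, and call b right dual to a (and a left
   dual to b) when there is a perfect pairing a ⊗ b -> K.  Both Serre functors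
   represent the same data.  The object S m carries a map e : [m, S m] -> K
   through which every map [m, x] -> K factors as [m, x] -> [m, S m] -> K for a
   unique x -> S m ([left_universal]).  Up to the duality G, the coHom of n is
   the internal Hom into n ([dcohom_ihom_iso]), so that
     Hom(T n, x) = Hom(1, coHom(n, x)) = Hom([x, n], K)
   and the inverse Serre object T n carries a map t : [T n, n] -> K through
   which every map [x, n] -> K factors for a unique T n -> x
   ([right_universal]).

   A map e : [m, s] -> K is called a Serre pairing if for every x the composite
     [x, s] ⊗ [m, x] -> [m, s] -> K
   of e with the composition of internal Homs is a perfect pairing.  In a
   GV-category a pairing that is perfect on one side is perfect on the other
   ([perfect_lr], [perfect_rl]), and this makes the notion self-dual:
   - if [m, -] is a strong module functor and e is left universal, then
     e is a Serre pairing, since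
       Hom(d, [x, s]) = Hom(d ▷ x, s) = Hom([m, d ▷ x], K)
                      = Hom(d ⊗ [m, x], K)
     ([serre_pairing_of_left]); dually for s and right universality
     ([serre_pairing_of_right]);
   - a Serre pairing has all the properties on both sides.  The module
     structure maps c ⊗ [m, x] -> [m, c ▷ x] and [x, s] ⊗ G c -> [c ▶ x, s]
     compare two perfect pairings with a common factor, because composition of
     internal Homs is associative ([icomp_assoc]); hence they are invertible.
     The second one is the oplax structure of coHom(s, -), up to G
     ([dcohom_ihom_oplax]).  Moreover [m, x] and coHom(s, x) are both right
     dual to [x, s], so these functors of x are isomorphic, and the known left
     adjoint - ▷ m of the first and the known right adjoint - ▶ s of the second
     serve both.  Evaluation at the unit object gives both universal
     properties of e.

   So S m lies in the second subcategory, T n in the first, and e : [m, S m] -> K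
   is right universal as t : [T (S m), S m] -> K is.  Objects with a universal
   map are unique, which gives T (S m) = m, and S (T n) = n likewise.
   Naturality follows from uniqueness: S f and T f are the maps compatible with
   the pairings ([intertwines]). *)

(** * Bijections and isomorphisms *)

(** Universal properties are expressed below as bijectivity of maps between
   Hom sets, and transported along the following three lemmas. *)
Lemma bij_comp_eq (X Y Z : Type) (f : Y -> Z) (g : X -> Y) (h : X -> Z) :
  bijective f -> bijective g -> (forall a, f (g a) = h a) -> bijective h.
Proof. by move=> bf bg E; apply: (eq_bij (bij_comp bf bg)). Qed.

Lemma bij_outer (X Y Z : Type) (f : Y -> Z) (g : X -> Y) (h : X -> Z) :
  bijective h -> bijective g -> (forall a, f (g a) = h a) -> bijective f.
Proof.
move=> bh [g' gK g'K] E; apply: (bij_comp_eq bh (g := g')).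
  by exists g.
by move=> a; rewrite -E g'K.
Qed.

Lemma bij_inner (X Y Z : Type) (f : Y -> Z) (g : X -> Y) (h : X -> Z) :
  bijective h -> bijective f -> (forall a, f (g a) = h a) -> bijective g.
Proof.
move=> bh [f' fK f'K] E; apply: (bij_comp_eq (f := f') _ bh).
  by exists f.
by move=> a; rewrite -E fK.
Qed.

Section Isomorphisms.
Variable A : Category.

Lemma is_iso_id (x : A) : is_iso (idm x).
Proof. by exists (idm x); rewrite comp1m. Qed.

Lemma is_iso_comp (x y z : A) (g : hom y z) (f : hom x y) :
  is_iso g -> is_iso f -> is_iso (g ∘ f).
Proof.
move=> [g' [g'g gg']] [f' [f'f ff']]; exists (f' ∘ g'); split.
  by rewrite compA -(compA f') g'g compm1.
by rewrite compA -(compA g) ff' compm1.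
Qed.

Lemma bij_precomp (x y z : A) (f : hom x y) :
  is_iso f -> bijective (fun g : hom y z => g ∘ f).
Proof.
move=> [f' [f'f ff']]; exists (fun g => g ∘ f') => g.
  by rewrite -compA ff' compm1.
by rewrite -compA f'f compm1.
Qed.

Lemma bij_postcomp (x y z : A) (f : hom y z) :
  is_iso f -> bijective (fun g : hom x y => f ∘ g).
Proof.
move=> [f' [f'f ff']]; exists (fun g => f' ∘ g) => g.
  by rewrite compA f'f comp1m.
by rewrite compA ff' comp1m.
Qed.

Lemma is_iso_yoneda (x y : A) (f : hom x y) :
  (forall d, bijective (fun g : hom d x => f ∘ g)) -> is_iso f.
Proof.
move=> bf; case: (bf y) => h hK Kh; exists (h (idm y)); split; last exact: Kh.
by apply: (bij_inj (bf x)); rewrite compA Kh comp1m compm1.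
Qed.

Lemma is_iso_cancel_l (x y z : A) (g : hom y z) (f : hom x y) :
  is_iso g -> is_iso (g ∘ f) -> is_iso f.
Proof.
move=> ig igf; apply: is_iso_yoneda => d.
by apply: (bij_inner (bij_postcomp d igf) (bij_postcomp d ig)) => a; rewrite compA.
Qed.

Lemma is_iso_cancel_r (x y z : A) (g : hom y z) (f : hom x y) :
  is_iso f -> is_iso (g ∘ f) -> is_iso g.
Proof.
move=> [f' [f'f ff']] igf.
have -> : g = (g ∘ f) ∘ f' by rewrite -compA ff' compm1.
by apply: is_iso_comp => //; exists f.
Qed.

End Isomorphisms.

Lemma is_iso_fmap (A B : Category) (F : Functor A B) (x y : A) (f : hom x y) :
  is_iso f -> is_iso (fmap F f).
Proof.
by move=> [g [gf fg]]; exists (fmap F g); rewrite -!fmapM gf fg !fmap1.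
Qed.

Lemma is_iso_bimap (A B D : Category) (F : Functor (prodC A B) D) (a a' : A)
    (b b' : B) (f : hom a a') (g : hom b b') :
  is_iso f -> is_iso g -> is_iso (bimap F f g).
Proof.
move=> [f' [f'f ff']] [g' [g'g gg']]; exists (bimap F f' g').
by rewrite !bimapM f'f ff' g'g gg' !bimap1.
Qed.

Lemma ni_bwd_nat (A B : Category) (F H : Functor A B) (t : NatIso F H)
    (x y : A) (f : hom x y) :
  fmap F f ∘ ni_bwd t x = ni_bwd t y ∘ fmap H f.
Proof.
by rewrite -[LHS]comp1m -(ni_fwdK t y) -compA (compA _ _ (ni_bwd t x)) ni_nat
           -(compA _ _ (ni_bwd t x)) ni_bwdK compm1.
Qed.

(** The components are only known to exist; a specification [P] that makes
   the squares commute allows them to be chosen independently. *)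
Lemma natiso_of_spec (A B : Category) (F H : Functor A B)
    (P : forall x, hom (F x) (H x) -> Prop) :
  (forall x, exists f, P x f /\ is_iso f) ->
  (forall x y (h : hom x y) f g,
     P x f -> P y g -> g ∘ fmap F h = fmap H h ∘ f) ->
  inhabited (NatIso F H).
Proof.
move=> ex nat; constructor.
have sel x : {fg : hom (F x) (H x) * hom (H x) (F x) |
    P x (fst fg) /\ snd fg ∘ fst fg = idm _ /\ fst fg ∘ snd fg = idm _}.
  apply: constructive_indefinite_description.
  by case: (ex x) => f [Pf [g fgK]]; exists (f, g).
unshelve refine {| ni_fwd := fun x => fst (proj1_sig (sel x));
                   ni_bwd := fun x => snd (proj1_sig (sel x)) |}.
- by move=> x; case: (proj2_sig (sel x)) => _ [].
- by move=> x; case: (proj2_sig (sel x)) => _ [].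
- move=> x y h; apply: nat.
    by case: (proj2_sig (sel x)).
  by case: (proj2_sig (sel y)).
Qed.

Lemma right_adjoint_natiso (A B : Category) (L L' : Functor A B) :
  NatIso L' L -> RightAdjoint L -> RightAdjoint L'.
Proof.
move=> t R; unshelve refine {| ra_fun := R; ra_adj := {|
  adjr := fun x y (f : hom (L' x) y) => adjr (ra_adj R) (f ∘ ni_bwd t x);
  adjl := fun x y (g : hom x (R y)) => adjl (ra_adj R) g ∘ ni_fwd t x |} |}.
- by move=> x y f /=; rewrite adjrK -compA ni_fwdK compm1.
- by move=> x y g /=; rewrite -compA ni_bwdK compm1 adjlK.
- by move=> x x' y f g /=; rewrite -adjr_natl -!compA ni_bwd_nat.
- by move=> x y y' h f /=; rewrite -adjr_natr compA.
Qed.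

Lemma left_adjoint_natiso (A B : Category) (R R' : Functor B A) :
  NatIso R R' -> LeftAdjoint R -> LeftAdjoint R'.
Proof.
move=> t L; unshelve refine {| la_fun := L; la_adj := {|
  adjr := fun x y (f : hom (L x) y) => ni_fwd t y ∘ adjr (la_adj L) f;
  adjl := fun x y (g : hom x (R' y)) => adjl (la_adj L) (ni_bwd t y ∘ g) |} |}.
- by move=> x y f /=; rewrite compA ni_fwdK comp1m adjrK.
- by move=> x y g /=; rewrite adjlK compA ni_bwdK comp1m.
- by move=> x x' y f g /=; rewrite adjr_natl compA.
- by move=> x y y' h f /=; rewrite adjr_natr !compA ni_nat.
Qed.

(** * Perfect pairings in a GV-category *)

Section PerfectPairings.
Variable C : GVCategory.

Definition Gmap (x y : C) (f : hom x y) : hom (G y) (G x) :=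
  @fmap (op C) C G y x f.

Definition Gev (y : C) : hom (G y ⊗ y) K := dual_ev (gv_dual C) y.

Lemma GmapM (x y z : C) (g : hom y z) (f : hom x y) :
  Gmap (g ∘ f) = Gmap f ∘ Gmap g.
Proof. exact: dual_mapM. Qed.

Lemma Gmap1 (x : C) : Gmap (idm x) = idm (G x).
Proof. exact: (@fmap1 (op C) C G x). Qed.

Lemma Gmap_ev (x y : C) (f : hom x y) :
  Gev x ∘ (Gmap f ⊗m idm x) = Gev y ∘ (idm (G y) ⊗m f).
Proof. exact: dual_map_ev. Qed.

Lemma Gmap_bij (x y : C) : bijective (@Gmap x y).
Proof.
exists (fun k : hom (G y) (G x) => @qi_preimage (op C) C G (gv_dual_inv C) y x k).
  by move=> f; apply: (@qi_preimageK (op C) C G (gv_dual_inv C) y x).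
by move=> k; apply: (@fmap_qi_preimage (op C) C G (gv_dual_inv C) y x).
Qed.

Lemma Gcounit_iso (x : C) : is_iso (Gcounit x).
Proof.
exists (ni_bwd (qi_counit (gv_dual_inv C)) x).
by split; [exact: (ni_fwdK (qi_counit (gv_dual_inv C)) x)
          | exact: (ni_bwdK (qi_counit (gv_dual_inv C)) x)].
Qed.

Lemma is_iso_Gmap (x y : C) (f : hom x y) : is_iso (Gmap f) -> is_iso f.
Proof.
move=> [k [kf fk]]; case: (Gmap_bij y x) => h hK Kh; exists (h k).
split; apply: (bij_inj (Gmap_bij _ _)); rewrite GmapM Kh Gmap1 //.
Qed.

Lemma Gmap_iso (x y : C) (f : hom x y) : is_iso f -> is_iso (Gmap f).
Proof. by move=> [k [kf fk]]; exists (Gmap k); rewrite -!GmapM kf fk !Gmap1. Qed.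

(** Since every object is isomorphic to some [G c], these suffice as test
   objects.  They are the convenient ones for [▶], where [Hom(n, c ▶ x)] is
   [Hom(G c ▷ n, x)]. *)
Lemma is_iso_yoneda_G (x y : C) (f : hom x y) :
  (forall c : C, bijective (fun g : hom (G c) x => f ∘ g)) -> is_iso f.
Proof.
move=> bf; apply: is_iso_yoneda => d; have ic := Gcounit_iso d.
apply: (bij_inner (f := fun g : hom d y => g ∘ Gcounit d)).
- exact: (bij_comp_eq (bf _) (bij_precomp x ic) (fun _ => erefl)).
- exact: bij_precomp.
- by move=> a /=; rewrite compA.
Qed.

Definition perfect_l (a b : C) (p : hom (a ⊗ b) K) : Prop :=
  forall d, bijective (fun f : hom d a => p ∘ (f ⊗m idm b)).

Definition perfect_r (a b : C) (p : hom (a ⊗ b) K) : Prop :=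
  forall d, bijective (fun f : hom d b => p ∘ (idm a ⊗m f)).

Lemma Gev_perfect_l (b : C) : perfect_l (Gev b).
Proof.
move=> d; exists (@dual_r C (gv_dual C) d b) => f.
  by rewrite -[RHS](dual_lK f) dual_lE.
by rewrite -dual_lE dual_rK.
Qed.

(** This is where fullness and faithfulness of [G] enter: a map into [b] is the
   same as a map out of [G b]. *)
Lemma Gev_perfect_r (b : C) : perfect_r (Gev b).
Proof.
move=> d; apply: (bij_comp_eq (Gev_perfect_l d (G b)) (Gmap_bij d b)) => f.
exact: Gmap_ev.
Qed.

Lemma perfect_l_mapl (a a' b : C) (p : hom (a ⊗ b) K) (k : hom a' a) :
  perfect_l p -> is_iso k -> perfect_l (p ∘ (k ⊗m idm b)).
Proof.
move=> pp ik d; apply: (bij_comp_eq (pp d) (bij_postcomp d ik)) => f.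
by rewrite bimapMl compA.
Qed.

Lemma perfect_l_mapr (a b b' : C) (p : hom (a ⊗ b) K) (k : hom b' b) :
  perfect_l p -> is_iso k -> perfect_l (p ∘ (idm a ⊗m k)).
Proof.
move=> pp ik d.
have ik' := is_iso_bimap (tens C) (is_iso_id d) ik.
apply: (bij_comp_eq (bij_precomp _ ik') (pp d)) => f.
by rewrite -!compA bimap_swap.
Qed.

Lemma perfect_r_mapl (a a' b : C) (p : hom (a ⊗ b) K) (k : hom a' a) :
  perfect_r p -> is_iso k -> perfect_r (p ∘ (k ⊗m idm b)).
Proof.
move=> pp ik d.
have ik' := is_iso_bimap (tens C) ik (is_iso_id d).
apply: (bij_comp_eq (bij_precomp _ ik') (pp d)) => f.
by rewrite -!compA bimap_swap.
Qed.

Lemma perfect_l_iso (a a' b : C) (p : hom (a ⊗ b) K) (k : hom a' a) :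
  perfect_l p -> perfect_l (p ∘ (k ⊗m idm b)) -> is_iso k.
Proof.
move=> pp pk; apply: is_iso_yoneda => d.
by apply: (bij_inner (pk d) (pp d)) => f; rewrite bimapMl compA.
Qed.

Lemma perfect_r_iso (a b b' : C) (p : hom (a ⊗ b) K) (k : hom b' b) :
  perfect_r p -> perfect_r (p ∘ (idm a ⊗m k)) -> is_iso k.
Proof.
move=> pp pk; apply: is_iso_yoneda => d.
by apply: (bij_inner (pk d) (pp d)) => f; rewrite bimapMr compA.
Qed.

(** A left perfect pairing is the evaluation of [b], up to an isomorphism of
   [a] with [G b]. *)
Lemma perfect_lr (a b : C) (p : hom (a ⊗ b) K) : perfect_l p -> perfect_r p.
Proof.
move=> pp; case: (Gev_perfect_l b a) => h _ /(_ p) hp.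
rewrite -hp; apply: (perfect_r_mapl (@Gev_perfect_r b)).
by apply: (perfect_l_iso (@Gev_perfect_l b)); rewrite hp.
Qed.

(** Transport the evaluation of [Ginv a] to a pairing of [a] with [Ginv a];
   it is perfect on both sides, so that [b] and [Ginv a] are right duals of the
   same object and [p] is this pairing up to an isomorphism of the two. *)
Lemma perfect_rl (a b : C) (p : hom (a ⊗ b) K) : perfect_r p -> perfect_l p.
Proof.
move=> pp; have [i [ci ic]] := Gcounit_iso a.
have ii : is_iso i by exists (Gcounit a).
have ql : perfect_l (Gev (Ginv a) ∘ (i ⊗m idm _)).
  exact: perfect_l_mapl (@Gev_perfect_l _) ii.
have qr := perfect_lr ql.
case: (qr b) => h _ /(_ p) hp; rewrite -hp; apply: (perfect_l_mapr ql).
by apply: (perfect_r_iso qr); rewrite hp.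
Qed.

(** The right dual of [a ⊗ b] is the internal Hom, for [b ⊗ -], into the right
   dual [x] of [a]; the hypothesis says that [y] is this internal Hom, with
   evaluation [v]. *)
Lemma perfect_r_assoc (a b x y : C) (p : hom (a ⊗ x) K) (v : hom (b ⊗ y) x) :
  perfect_r p ->
  (forall d, bijective (fun f : hom d y => v ∘ (idm b ⊗m f))) ->
  perfect_r (p ∘ (idm a ⊗m v) ∘ massoc a b y).
Proof.
move=> pp bv d.
apply: (bij_comp_eq (bij_precomp _ (massoc_iso a b d))
  (bij_comp_eq (pp _) (bv d) (fun _ => erefl))) => f.
rewrite -[idm (a ⊗ b)](bimap1 (tens C)) -!compA massoc_nat.
by rewrite [in RHS](compA (idm a ⊗m v)) -bimapMr.
Qed.

(** The mirror image, with [a] the internal Hom for [- ⊗ b] into [x].  Here the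
   new pairing lives on the other bracketing and is given by its composite
   with the associator, which avoids the inverse of the latter. *)
Lemma perfect_l_assoc (a b x y : C) (p : hom (x ⊗ y) K) (v : hom (a ⊗ b) x)
    (q : hom (a ⊗ (b ⊗ y)) K) :
  perfect_l p ->
  (forall d, bijective (fun f : hom d a => v ∘ (f ⊗m idm b))) ->
  p ∘ (v ⊗m idm y) = q ∘ massoc a b y ->
  perfect_l q.
Proof.
move=> pp bv E d.
apply: (bij_inner (bij_comp_eq (pp _) (bv d) (fun _ => erefl))
  (bij_precomp _ (massoc_iso d b y))) => f /=.
rewrite bimapMl compA E -!compA massoc_nat.
by rewrite (bimap1 (tens C)).
Qed.

End PerfectPairings.

(** * Composition of internal Homs *)

Section InternalHom.
Variables (C : GVCategory) (M : GVModuleCategory C).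

Definition curry (b : C) (y s : M) (u : hom (b ▷ y) s) : hom b (ihom y s) :=
  @adjr C M (act_r y) (ihom y) (ra_adj (ihom y)) b s u.

Lemma ev_curry (b : C) (y s : M) (u : hom (b ▷ y) s) :
  ihom_ev y s ∘ (curry u ▷m idm y) = u.
Proof. exact: (counit_adjr (ihom y)). Qed.

Lemma ev_inj (b : C) (y s : M) (f g : hom b (ihom y s)) :
  ihom_ev y s ∘ (f ▷m idm y) = ihom_ev y s ∘ (g ▷m idm y) -> f = g.
Proof. exact: (counit_inj (R := ihom y)). Qed.

Lemma ev_bij (b : C) (y s : M) :
  bijective (fun f : hom b (ihom y s) => ihom_ev y s ∘ (f ▷m idm y)).
Proof.
exists (@curry b y s) => f; last exact: ev_curry.
by apply: ev_inj; rewrite ev_curry.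
Qed.

Definition coact_ev (c : C) (x : M) : hom (G c ▷ (c ▶ x)) x :=
  counit (coact c) x.

Lemma coact_ev_bij (n x : M) (c : C) :
  bijective (fun g : hom n (c ▶ x) => coact_ev c x ∘ (idm (G c) ▷m g)).
Proof.
exists (fun k => @adjr M M (act_l M (G c)) _ (ra_adj (coact c)) _ _ k) => k.
  by apply: (counit_inj (R := coact c)); rewrite counit_adjr.
exact: (counit_adjr (coact c)).
Qed.

Lemma ihom_map_ev (m n n' : M) (h : hom n n') :
  ihom_ev m n' ∘ (fmap (ihom m) h ▷m idm m) = h ∘ ihom_ev m n.
Proof. exact: (counit_nat (ihom m)). Qed.

Lemma ihom_lax_ev (m : M) (c : C) (n : M) :
  ihom_ev m (c ▷ n) ∘ (ihom_lax m c n ▷m idm m) =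
  (idm c ▷m ihom_ev m n) ∘ aassoc c (ihom m n) m.
Proof. exact: ev_curry. Qed.

(** Internal precomposition with [u : b ▷ y -> x].  This one operation covers
   the composition of internal Homs ([u] an evaluation), the structure map
   [ihom(x, s) ⊗ G c -> ihom(c ▶ x, s)] ([u] the counit of [▶]) and the
   universal map [ihom(b ▷ y, s) ⊗ b -> ihom(y, s)] ([u] the identity). *)
Definition ihom_ext (b : C) (y x s : M) (u : hom (b ▷ y) x) :
  hom (ihom x s ⊗ b) (ihom y s) :=
  curry (ihom_ev x s ∘ (idm (ihom x s) ▷m u) ∘ aassoc (ihom x s) b y).

(** Internal postcomposition with [u]; the lax structure is the case of the
   identity. *)
Definition ihom_post (m : M) (b : C) (y x : M) (u : hom (b ▷ y) x) :
  hom (b ⊗ ihom m y) (ihom m x) :=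
  fmap (ihom m) u ∘ ihom_lax m b y.

Definition icomp (m x s : M) : hom (ihom x s ⊗ ihom m x) (ihom m s) :=
  ihom_ext s (ihom_ev m x).

Lemma aassoc_natl (c c' d : C) (m : M) (f : hom c c') :
  aassoc c' d m ∘ ((f ⊗m idm d) ▷m idm m) =
  (f ▷m idm (d ▷ m)) ∘ aassoc c d m.
Proof. by rewrite aassoc_nat bimap1. Qed.

Lemma aassoc_natm (c d d' : C) (m : M) (f : hom d d') :
  aassoc c d' m ∘ ((idm c ⊗m f) ▷m idm m) =
  (idm c ▷m (f ▷m idm m)) ∘ aassoc c d m.
Proof. by rewrite aassoc_nat. Qed.

Lemma aassoc_natr (c d : C) (m m' : M) (f : hom m m') :
  aassoc c d m' ∘ (idm (c ⊗ d) ▷m f) =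
  (idm c ▷m (idm d ▷m f)) ∘ aassoc c d m.
Proof. by rewrite -(bimap1 (tens C)) aassoc_nat. Qed.

Lemma ihom_ext_ev (b : C) (y x s : M) (u : hom (b ▷ y) x) :
  ihom_ev y s ∘ (ihom_ext s u ▷m idm y) =
  ihom_ev x s ∘ (idm (ihom x s) ▷m u) ∘ aassoc (ihom x s) b y.
Proof. exact: ev_curry. Qed.

Lemma ihom_post_ev (m : M) (b : C) (y x : M) (u : hom (b ▷ y) x) :
  ihom_ev m x ∘ (ihom_post m u ▷m idm m) =
  u ∘ (idm b ▷m ihom_ev m y) ∘ aassoc b (ihom m y) m.
Proof.
by rewrite /ihom_post bimapMl compA ihom_map_ev -compA ihom_lax_ev compA.
Qed.

(** The form in which extensions are computed: if [f] is the curried form of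
   [k : a ▷ x -> s], both sides are [k] precomposed with [u]. *)
Lemma ihom_ext_curry (a b : C) (y x s : M) (u : hom (b ▷ y) x)
    (f : hom a (ihom x s)) :
  ihom_ev y s ∘ ((ihom_ext s u ∘ (f ⊗m idm b)) ▷m idm y) =
  ihom_ev x s ∘ (f ▷m idm x) ∘ (idm a ▷m u) ∘ aassoc a b y.
Proof.
rewrite bimapMl compA ihom_ext_ev -!compA aassoc_natl.
by rewrite !(compA _ _ (aassoc a b y)) bimap_swap.
Qed.

Lemma ihom_ext_mapr (b b' : C) (y x s : M) (u : hom (b ▷ y) x) (f : hom b' b) :
  ihom_ext s u ∘ (idm (ihom x s) ⊗m f) = ihom_ext s (u ∘ (f ▷m idm y)).
Proof.
apply: ev_inj; rewrite bimapMl compA !ihom_ext_ev -!compA aassoc_natm.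
by rewrite bimapMr !compA.
Qed.

Lemma ihom_ext_pre (b : C) (y y' x s : M) (u : hom (b ▷ y) x) (h : hom y' y) :
  ihom_pre h s ∘ ihom_ext s u = ihom_ext s (u ∘ (idm b ▷m h)).
Proof.
apply: ev_inj; rewrite bimapMl compA ihom_pre_ev -compA -bimap_swap compA.
by rewrite !ihom_ext_ev -!compA aassoc_natr bimapMr !compA.
Qed.

Lemma ihom_ext_mapl (b : C) (y x x' s : M) (u : hom (b ▷ y) x) (h : hom x x') :
  ihom_ext s u ∘ (ihom_pre h s ⊗m idm b) = ihom_ext s (h ∘ u).
Proof.
apply: ev_inj; rewrite ihom_ext_curry ihom_pre_ev ihom_ext_ev.
by rewrite bimapMr !compA.
Qed.

Lemma icomp_mapr (m x s : M) (d : C) (f : hom d (ihom m x)) :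
  icomp m x s ∘ (idm _ ⊗m f) = ihom_ext s (ihom_ev m x ∘ (f ▷m idm m)).
Proof. exact: ihom_ext_mapr. Qed.

Lemma icomp_mapl (m x s : M) (d : C) (f : hom d (ihom x s)) :
  icomp m x s ∘ (f ⊗m idm _) = ihom_post m (ihom_ev x s ∘ (f ▷m idm x)).
Proof. by apply: ev_inj; rewrite ihom_ext_curry ihom_post_ev. Qed.

Lemma icomp_dinat (m x x' s : M) (h : hom x x') :
  icomp m x s ∘ (ihom_pre h s ⊗m idm _) =
  icomp m x' s ∘ (idm _ ⊗m fmap (ihom m) h).
Proof. by rewrite ihom_ext_mapl icomp_mapr ihom_map_ev. Qed.

(** Both sides internalise the composite of [m -> y], [u : b ▷ y -> x] and
   [x -> s], bracketed differently; the pentagon of the action identifies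
   them. *)
Lemma icomp_assoc (m x y s : M) (b : C) (u : hom (b ▷ y) x) :
  icomp m y s ∘ (ihom_ext s u ⊗m idm (ihom m y)) =
  icomp m x s ∘ (idm (ihom x s) ⊗m ihom_post m u) ∘ massoc _ _ _.
Proof.
apply: ev_inj; rewrite ihom_ext_curry ihom_ext_ev.
rewrite icomp_mapr bimapMl [in RHS]compA ihom_ext_ev ihom_post_ev.
rewrite !bimapMr -!compA; congr (_ ∘ (_ ∘ _)).
by rewrite [X in _ = _ ∘ X]compA -apentagon !compA aassoc_natr.
Qed.

(** [ihom(b ▷ y, s)] is the internal Hom, for [- ⊗ b], into [ihom(y, s)]. *)
Lemma ihom_ext_id_bij (b : C) (y s : M) (d : C) :
  bijective (fun f : hom d (ihom (b ▷ y) s) =>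
    ihom_ext s (idm (b ▷ y)) ∘ (f ⊗m idm b)).
Proof.
apply: (bij_inner _ (ev_bij _ _ _) (fun f => ihom_ext_curry _ f)).
rewrite (bimap1 (act M)).
apply: (bij_comp_eq (bij_precomp _ (aassoc_iso _ _ _)) (ev_bij _ _ _)) => f /=.
by rewrite compm1.
Qed.

(** [ihom(m, c ▶ x)] is the internal Hom, for [G c ⊗ -], into [ihom(m, x)],
   because maps [d ▷ m -> c ▶ x] are maps [G c ▷ d ▷ m -> x]. *)
Lemma ihom_post_counit_bij (m x : M) (c d : C) :
  bijective (fun f : hom d (ihom m (c ▶ x)) =>
    ihom_post m (coact_ev c x) ∘ (idm (G c) ⊗m f)).
Proof.
apply: (bij_inner _ (ev_bij _ _ _) (fun f => erefl)) => /=.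
apply: (bij_comp_eq (bij_precomp _ (aassoc_iso _ _ _))
  (bij_comp_eq (coact_ev_bij _ _ _) (ev_bij _ _ _) (fun _ => erefl))) => f /=.
rewrite bimapMl compA ihom_post_ev bimapMr -!compA aassoc_natm.
by rewrite !compA.
Qed.

Lemma ihom_ext_aunit (m s : M) : ihom_ext s (aunit m) = mrunit (ihom m s).
Proof. by apply: ev_inj; rewrite ihom_ext_ev -compA atriangle. Qed.

End InternalHom.

(** * Serre pairings *)

Section SerrePairing.
Variables (C : GVCategory) (M : GVModuleCategory C).

(** [s] represents the presheaf [x |-> Hom(ihom(m, x), K)], as [S m] does. *)
Definition left_universal (m s : M) (e : hom (ihom m s) K) : Prop :=
  forall x : M, bijective (fun g : hom x s => e ∘ fmap (ihom m) g).

(** [m] represents the functor [x |-> Hom(ihom(x, s), K)], as the inverse Serre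
   object of [s] does. *)
Definition right_universal (m s : M) (e : hom (ihom m s) K) : Prop :=
  forall x : M, bijective (fun h : hom m x => e ∘ ihom_pre h s).

Definition serre_pairing (m s : M) (e : hom (ihom m s) K) : Prop :=
  forall x : M, perfect_l (e ∘ icomp m x s).

(** Strength of the coHom functor of [s] in terms of internal Homs into [s];
   see [icohom_strongP]. *)
Definition ext_strong (s : M) : Prop :=
  forall (c : C) (x : M),
    is_iso (ihom_ext s (coact_ev c x)).

(** [Hom(d, ihom(x, s)) = Hom(d ▷ x, s) = Hom(ihom(m, d ▷ x), K)
   = Hom(d ⊗ ihom(m, x), K)], by currying, left universality and strength. *)
Lemma serre_pairing_of_left (m s : M) (e : hom (ihom m s) K) :
  ihom_strong m -> left_universal e -> serre_pairing e.
Proof.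
move=> sm ue x d.
apply: (bij_comp_eq (bij_precomp _ (sm d x))
  (bij_comp_eq (ue _) (ev_bij d x s) (fun _ => erefl))) => f /=.
by rewrite -!compA icomp_mapl.
Qed.

(** For [d = G c] one has [Hom(G c, ihom(m, x)) = Hom(G c ▷ m, x)
   = Hom(m, c ▶ x) = Hom(ihom(c ▶ x, s), K) = Hom(ihom(x, s) ⊗ G c, K)]; every
   object is isomorphic to such a [d]. *)
Lemma serre_pairing_of_right (m s : M) (e : hom (ihom m s) K) :
  ext_strong s -> right_universal e -> serre_pairing e.
Proof.
move=> ss ue x; apply: perfect_rl => d.
have bG c : bijective (fun f : hom (G c) (ihom m x) =>
    e ∘ icomp m x s ∘ (idm _ ⊗m f)).
  have bc := bij_comp_eq (bij_precomp K (ss c x)) (ue (c ▶ x)) (fun _ => erefl).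
  case: (coact_ev_bij m x c) => k kK Kk.
  apply: (bij_comp_eq (g := fun f : hom (G c) (ihom m x) =>
    k (ihom_ev m x ∘ (f ▷m idm m))) bc).
    apply: (bij_comp_eq _ (ev_bij _ _ _) (fun _ => erefl)).
    exact: Bijective Kk kK.
  by move=> f; rewrite -!compA ihom_ext_pre icomp_mapr Kk.
have ic := Gcounit_iso d.
apply: (bij_inner (f := fun q => q ∘ (idm (ihom x s) ⊗m Gcounit d))).
- exact: (bij_comp_eq (bG _) (bij_precomp (ihom m x) ic) (fun _ => erefl)).
- exact: (bij_precomp _ (is_iso_bimap (tens C) (is_iso_id _) ic)).
- by move=> f /=; rewrite -[LHS]compA -bimapMr.
Qed.

Section Consequences.
Variables (m s : M) (e : hom (ihom m s) K).
Hypothesis pe : serre_pairing e.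

(** [ihom(m, c ▷ x)] and [c ⊗ ihom(m, x)] are both right dual to
   [ihom(c ▷ x, s)], the first by hypothesis, the second because
   [ihom(c ▷ x, s)] is the internal Hom, for [- ⊗ c], into [ihom(x, s)]; the lax
   structure map intertwines the two pairings. *)
Lemma serre_pairing_ihom_strong : ihom_strong m.
Proof.
move=> c x; apply: (perfect_r_iso (perfect_lr (pe (c ▷ x)))); apply: perfect_lr.
apply: (perfect_l_assoc (pe x) (@ihom_ext_id_bij C M c x s)).
by rewrite -!compA icomp_assoc /ihom_post fmap1 comp1m !compA.
Qed.

(** The mirror image: [ihom(c ▶ x, s)] and [ihom(x, s) ⊗ G c] are both left
   dual to [ihom(m, c ▶ x)]. *)
Lemma serre_pairing_ext_strong : ext_strong s.
Proof.
move=> c x; apply: (perfect_l_iso (pe (c ▶ x))); rewrite -compA icomp_assoc.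
rewrite !compA; apply: perfect_rl.
by apply: (perfect_r_assoc (perfect_lr (pe x))); apply: ihom_post_counit_bij.
Qed.

Lemma bij_aunit (x y : M) : bijective (fun g : hom x y => g ∘ aunit x).
Proof. exact: bij_precomp (aunit_iso x). Qed.

(** Perfectness tested at [d = one]: a map [one -> ihom(x, s)] is a map
   [x -> s].  Comparing the resulting pairing with [e] only requires that the
   composite [one ⊗ ihom(m, x) -> ihom(m, one ▷ x) -> ihom(m, x)] be invertible. *)
Lemma serre_pairing_left : left_universal e.
Proof.
move=> x.
have il : is_iso (fmap (ihom m) (aunit x) ∘ ihom_lax m one x).
  apply: is_iso_comp; last exact: serre_pairing_ihom_strong.
  exact: is_iso_fmap (aunit_iso x).
apply: (bij_inner _ (bij_precomp K il) (fun g => erefl)).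
apply: (bij_comp_eq (f := fun g : hom (one ▷ x) s =>
  e ∘ fmap (ihom m) g ∘ ihom_lax m one x) _ (bij_aunit x s)) => [|g].
  apply: (bij_outer (pe x one) (ev_bij _ _ _)) => f.
  by rewrite -!compA icomp_mapl.
by rewrite fmapM !compA.
Qed.

(** Again perfectness at [d = one], with maps [one -> ihom(m, x)]; here the
   comparison map is the right unitor of [ihom(x, s)]. *)
Lemma serre_pairing_right : right_universal e.
Proof.
move=> x.
apply: (bij_inner _ (bij_precomp K (mrunit_iso (ihom x s))) (fun g => erefl)).
apply: (bij_comp_eq (f := fun g : hom (one ▷ m) x => e ∘ ihom_ext s g)
  _ (bij_aunit m x)) => [|g].
  apply: (bij_outer (perfect_lr (pe x) one) (ev_bij _ _ _)) => f.
  by rewrite -!compA icomp_mapr.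
by rewrite -ihom_ext_mapl ihom_ext_aunit mrunit_nat compA.
Qed.

End Consequences.
End SerrePairing.

(** * Internal coHoms as predual internal Homs *)

Section CoHom.
Variables (C : GVCategory) (M : GVModuleCategory C).
Variable W : forall m : M, LeftAdjoint (coact_r m).

(** The coevaluation [x -> W s x ▶ s] read through the adjunction that
   defines [▶]. *)
Definition dcohom_ev (s x : M) : hom (G (W s x) ▷ x) s :=
  coact_ev (W s x) s
    ∘ (idm (G (W s x)) ▷m icohom_coev W s x).

Definition dcohom_ihom (s x : M) : hom (G (W s x)) (ihom x s) :=
  curry (dcohom_ev s x).

Lemma dcohom_ihom_ev (s x : M) :
  ihom_ev x s ∘ (dcohom_ihom s x ▷m idm x) = dcohom_ev s x.
Proof. exact: ev_curry. Qed.

Lemma dcohom_ev_Gmap (s x : M) (c : C) (h : hom (W s x) c) :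
  dcohom_ev s x ∘ (Gmap h ▷m idm x) =
  coact_ev c s
    ∘ (idm (G c) ▷m (coact_map h s ∘ icohom_coev W s x)).
Proof.
by rewrite /dcohom_ev -compA -bimap_swap bimapMr !compA coact_map_counit.
Qed.

(** [Hom(G c, G (W s x)) = Hom(W s x, c) = Hom(x, c ▶ s) = Hom(G c ▷ x, s)
   = Hom(G c, ihom(x, s))]. *)
Lemma dcohom_ihom_iso (s x : M) : is_iso (dcohom_ihom s x).
Proof.
apply: is_iso_yoneda_G => c.
apply: (bij_outer (h := fun h : hom (W s x) c => dcohom_ihom s x ∘ Gmap h)
  _ (Gmap_bij _ _)) => [|//].
apply: (bij_inner _ (ev_bij _ _ _) (fun f => erefl)) => /=.
have bw : bijective (fun h : hom (W s x) c => coact_map h s ∘ icohom_coev W s x).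
  exists (fun k => adjl (la_adj (W s)) (k : hom x (coact_r s c))) => k.
    by apply: (unit_inj (L := W s)); rewrite unit_adjl.
  exact: (unit_adjl (W s)).
apply: (bij_comp_eq (coact_ev_bij x s c) bw) => h.
by rewrite bimapMl compA dcohom_ihom_ev dcohom_ev_Gmap.
Qed.

Lemma dcohom_ihom_pre (s x x' : M) (h : hom x x') :
  ihom_pre h s ∘ dcohom_ihom s x' =
  dcohom_ihom s x ∘ Gmap (fmap (W s) h).
Proof.
apply: ev_inj; rewrite !bimapMl !compA ihom_pre_ev dcohom_ihom_ev.
rewrite dcohom_ev_Gmap -compA -bimap_swap compA dcohom_ihom_ev -compA.
rewrite -bimapMr; congr (_ ∘ (_ ▷m _)); symmetry.
exact: (unit_nat (W s) h).
Qed.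

Lemma dcohom_ihom_post (s s' x : M) (f : hom s s') :
  fmap (ihom x) f ∘ dcohom_ihom s x =
  dcohom_ihom s' x ∘ Gmap (icohom_pre W f x).
Proof.
apply: ev_inj; rewrite !bimapMl !compA ihom_map_ev -compA !dcohom_ihom_ev.
rewrite dcohom_ev_Gmap icohom_pre_coev bimapMr !compA; congr (_ ∘ _).
by rewrite (counit_nat (coact (W s x)) f).
Qed.

(** After [G], the oplax structure of coHom is the precomposition of internal
   Homs with the counit of [▶]: the identification of [▶] with an action of
   [⊙] is defined by the same mate. *)
Lemma dcohom_ihom_oplax (s x : M) (c : C) :
  dcohom_ihom s (c ▶ x) ∘ Gmap (icohom_oplax W s c x) =
  ihom_ext s (coact_ev c x)
    ∘ (dcohom_ihom s x ⊗m idm (G c)) ∘ Gcounit (G (W s x) ⊗ G c).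
Proof.
apply: ev_inj; rewrite bimapMl compA dcohom_ihom_ev dcohom_ev_Gmap.
rewrite [coact_map _ _ ∘ _](unit_adjl (W s)) bimapMr compA.
rewrite [_ ∘ (_ ▷m coact_assoc _ _ _)](counit_adjr (coact (c ⊙ W s x))).
rewrite [X in _ = _ ∘ X]bimapMl [in RHS]compA ihom_ext_curry dcohom_ihom_ev.
rewrite -!compA bimap_swap (compA (aassoc _ _ _)) aassoc_natr -!compA.
congr (_ ∘ _); rewrite !compA -!bimapMr; congr (_ ▷m _ ∘ _ ∘ _).
exact: (counit_nat (coact c) (icohom_coev W s x)).
Qed.

Lemma icohom_strongP (s : M) : icohom_strong W s <-> ext_strong s.
Proof.
have key c x : is_iso (icohom_oplax W s c x) <->
    is_iso (ihom_ext s (coact_ev c x)).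
  have i1 : is_iso (dcohom_ihom s x ⊗m idm (G c)).
    exact: is_iso_bimap (dcohom_ihom_iso s x) (is_iso_id _).
  have i2 := Gcounit_iso (G (W s x) ⊗ G c).
  have E := dcohom_ihom_oplax s x c; split=> i.
    apply: (is_iso_cancel_r i1); apply: (is_iso_cancel_r i2); rewrite -E.
    by apply: is_iso_comp; [exact: dcohom_ihom_iso | exact: Gmap_iso].
  apply: is_iso_Gmap; apply: (is_iso_cancel_l (dcohom_ihom_iso s (c ▶ x))).
  by rewrite E; apply: is_iso_comp => //; apply: is_iso_comp.
by split=> H c x; apply/key.
Qed.

(** A Serre pairing makes [ihom(m, x)] right dual to [ihom(x, s)], hence to
   [G (W s x)], whose right dual is [W s x].  Naturality in [x] is
   dinaturality of the two pairings. *)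
Lemma serre_pairing_natiso (m s : M) (e : hom (ihom m s) K) :
  serre_pairing e -> inhabited (NatIso (ihom m) (W s)).
Proof.
move=> pe.
apply: (natiso_of_spec (P := fun x (f : hom (ihom m x) (W s x)) =>
  Gev (W s x) ∘ (idm _ ⊗m f) =
  e ∘ icomp m x s ∘ (dcohom_ihom s x ⊗m idm _))) => [x|x y h f g Ef Eg].
  case: (@Gev_perfect_r C (W s x) (ihom m x)) => k _.
  move/(_ (e ∘ icomp m x s ∘ (dcohom_ihom s x ⊗m idm _))) => E.
  exists (k (e ∘ icomp m x s ∘ (dcohom_ihom s x ⊗m idm _))); split=> //.
  apply: (perfect_r_iso (@Gev_perfect_r C (W s x))); rewrite E.
  apply: perfect_lr; exact: perfect_l_mapl (pe x) (dcohom_ihom_iso s x).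
apply: (bij_inj (@Gev_perfect_r C _ _)).
rewrite !bimapMr !compA Eg -Gmap_ev -[in RHS]compA bimap_swap.
rewrite [in RHS]compA Ef -!compA bimap_swap -bimapMl -dcohom_ihom_pre.
rewrite bimapMl; congr (_ ∘ _); rewrite !compA; congr (_ ∘ _).
by rewrite icomp_dinat.
Qed.

(** [- ▶ s] is right adjoint to [W s], hence to the isomorphic functor
   [ihom m]. *)
Lemma serre_pairing_hat_otimes (m s : M) (e : hom (ihom m s) K) :
  serre_pairing e -> hat_otimes m.
Proof.
move=> pe; split; first exact: serre_pairing_ihom_strong pe.
case: (serre_pairing_natiso pe) => t; constructor.
exact: (right_adjoint_natiso t {| ra_fun := coact_r s; ra_adj := la_adj (W s) |}).
Qed.

(** [- ▷ m] is left adjoint to [ihom m], hence to the isomorphic functor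
   [W s]. *)
Lemma serre_pairing_hat_odot (m s : M) (e : hom (ihom m s) K) :
  serre_pairing e -> hat_odot W s.
Proof.
move=> pe; split; first exact/icohom_strongP/(serre_pairing_ext_strong pe).
case: (serre_pairing_natiso pe) => t; constructor.
exact: (left_adjoint_natiso t {| la_fun := act_r m; la_adj := ra_adj (ihom m) |}).
Qed.

End CoHom.

(** * Morphisms of pairings *)

Section Intertwiners.
Variables (C : GVCategory) (M : GVModuleCategory C).

(** Compatibility of [f : m -> m'] and [g : s -> s'] with the pairings: the two
   maps from [ihom(m', s)] to [K] agree.  Each of [f] and [g] determines the
   other when [e] is right universal and [e'] is left universal. *)
Definition intertwines (m s m' s' : M) (e : hom (ihom m s) K)
    (e' : hom (ihom m' s') K) (f : hom m m') (g : hom s s') : Prop :=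
  e ∘ ihom_pre f s = e' ∘ fmap (ihom m') g.

Lemma intertwines1 (m s : M) (e : hom (ihom m s) K) :
  intertwines e e (idm m) (idm s).
Proof. by rewrite /intertwines ihom_pre1 fmap1. Qed.

Lemma intertwines_comp (m s m' s' m'' s'' : M) (e : hom (ihom m s) K)
    (e' : hom (ihom m' s') K) (e'' : hom (ihom m'' s'') K)
    (f : hom m m') (g : hom s s') (f' : hom m' m'') (g' : hom s' s'') :
  intertwines e e' f g -> intertwines e' e'' f' g' ->
  intertwines e e'' (f' ∘ f) (g' ∘ g).
Proof.
rewrite /intertwines => E E'.
by rewrite ihom_preM compA E -compA -ihom_pre_nat compA E' -compA -fmapM.
Qed.

Lemma right_universal_unique (m s m' s' : M) (e : hom (ihom m s) K)
    (e' : hom (ihom m' s') K) (f f' : hom m m') (g : hom s s') :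
  right_universal e -> intertwines e e' f g -> intertwines e e' f' g -> f = f'.
Proof. by move=> ue E E'; apply: (bij_inj (ue m')); rewrite E E'. Qed.

Lemma left_universal_unique (m s m' s' : M) (e : hom (ihom m s) K)
    (e' : hom (ihom m' s') K) (f : hom m m') (g g' : hom s s') :
  left_universal e' -> intertwines e e' f g -> intertwines e e' f g' -> g = g'.
Proof. by move=> ue E E'; apply: (bij_inj (ue s)); rewrite -E -E'. Qed.

Lemma right_universal_exists (m s m' s' : M) (e : hom (ihom m s) K)
    (e' : hom (ihom m' s') K) (g : hom s s') :
  right_universal e -> exists f, intertwines e e' f g.
Proof.
move=> ue; case: (ue m') => h _ hK; exists (h (e' ∘ fmap (ihom m') g)).
exact: hK.
Qed.

Lemma left_universal_exists (m s m' s' : M) (e : hom (ihom m s) K)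
    (e' : hom (ihom m' s') K) (f : hom m m') :
  left_universal e' -> exists g, intertwines e e' f g.
Proof.
move=> ue; case: (ue s) => h _ hK; exists (h (e ∘ ihom_pre f s)).
by symmetry; exact: hK.
Qed.

Lemma right_universal_iso (m m' s : M) (e : hom (ihom m s) K)
    (e' : hom (ihom m' s) K) :
  right_universal e -> right_universal e' ->
  exists f, intertwines e e' f (idm s) /\ is_iso f.
Proof.
move=> ue ue'; case: (right_universal_exists e' (idm s) ue) => f E.
case: (right_universal_exists e (idm s) ue') => f' E'.
exists f; split=> //; exists f'; split.
  apply: (right_universal_unique ue _ (intertwines1 e)).
  by rewrite -[idm s]comp1m; apply: intertwines_comp E E'.
apply: (right_universal_unique ue' _ (intertwines1 e')).
by rewrite -[idm s]comp1m; apply: intertwines_comp E' E.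
Qed.

Lemma left_universal_iso (m s s' : M) (e : hom (ihom m s) K)
    (e' : hom (ihom m s') K) :
  left_universal e -> left_universal e' ->
  exists g, intertwines e e' (idm m) g /\ is_iso g.
Proof.
move=> ue ue'; case: (left_universal_exists e (idm m) ue') => g E.
case: (left_universal_exists e' (idm m) ue) => g' E'.
exists g; split=> //; exists g'; split.
  apply: (left_universal_unique ue _ (intertwines1 e)).
  by rewrite -[idm m]comp1m; apply: intertwines_comp E E'.
apply: (left_universal_unique ue' _ (intertwines1 e')).
by rewrite -[idm m]comp1m; apply: intertwines_comp E' E.
Qed.

End Intertwiners.

(** * The pairings of the two relative Serre functors *)

Section SerreFunctors.
Variables (C : GVCategory) (M : GVModuleCategory C).
Variable Yra : forall m : Mhat_otimes M, RightAdjoint (ihom (proj1_sig m)).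

Definition serre_ev (m : Mhat_otimes M) :
  hom (ihom (proj1_sig m) (serre Yra m)) K := counit (Yra m) K.

Lemma serre_ev_left (m : Mhat_otimes M) : left_universal (serre_ev m).
Proof.
move=> x; exists (fun k => adjr (ra_adj (Yra m)) k) => k.
  by apply: (counit_inj (R := Yra m)); rewrite counit_adjr.
exact: (counit_adjr (Yra m)).
Qed.

Lemma serre_ev_pairing (m : Mhat_otimes M) : serre_pairing (serre_ev m).
Proof.
apply: serre_pairing_of_left (@serre_ev_left m).
by case: (proj2_sig m).
Qed.

Lemma serre_ev_intertwines (m m' : Mhat_otimes M) (f : hom m m') :
  intertwines (serre_ev m) (serre_ev m') f (fmap (serre Yra) f).
Proof. by symmetry; exact: serre_map_counit. Qed.

Variable W : forall m : M, LeftAdjoint (coact_r m).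
Variable Wla : forall m : Mhat_odot W, LeftAdjoint (W (proj1_sig m)).

(** The image of [j] under [Hom(one, c) = Hom(G c, G one)
   = Hom(G c ⊗ one, K)]; the factor [one] is kept to avoid inverting a
   unitor. *)
Definition point_pairing (c : C) (j : hom one c) : hom (G c ⊗ one) K :=
  Gev one ∘ (Gmap j ⊗m idm one).

(** The universal point [one -> W n (T n)], turned into a map
   [G (W n (T n)) -> K] and transported along the isomorphism of
   [G (W n (T n))] with [ihom(T n, n)]. *)
Lemma inv_serre_ev_exists (n : Mhat_odot W) :
  exists t : hom (ihom (inv_serre Wla n) (proj1_sig n)) K,
    t ∘ (dcohom_ihom W (proj1_sig n) (inv_serre Wla n) ∘ mrunit _) =
    point_pairing (Defs.unit (Wla n) one).
Proof.
have i := is_iso_comp (dcohom_ihom_iso W (proj1_sig n) (inv_serre Wla n))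
  (mrunit_iso _).
case: (bij_precomp K i) => h _ hK; eexists; exact: hK.
Qed.

Definition inv_serre_ev (n : Mhat_odot W) :
    hom (ihom (inv_serre Wla n) (proj1_sig n)) K :=
  proj1_sig (constructive_indefinite_description _ (inv_serre_ev_exists n)).

Lemma inv_serre_evE (n : Mhat_odot W) (c : C)
    (h : hom (W (proj1_sig n) (inv_serre Wla n)) c) :
  inv_serre_ev n ∘ dcohom_ihom W (proj1_sig n) (inv_serre Wla n) ∘ Gmap h
    ∘ mrunit _ =
  point_pairing (h ∘ Defs.unit (Wla n) one).
Proof.
rewrite -compA -mrunit_nat compA -(compA (inv_serre_ev n)).
rewrite (proj2_sig (constructive_indefinite_description _ (inv_serre_ev_exists n))).
by rewrite /point_pairing -compA -bimapMl -GmapM.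
Qed.

(** [Hom(T n, x) = Hom(one, W n x) = Hom(G (W n x), G one) = Hom(ihom(x, n), K)]. *)
Lemma inv_serre_ev_right (n : Mhat_odot W) : right_universal (inv_serre_ev n).
Proof.
move=> x.
have i := is_iso_comp (dcohom_ihom_iso W (proj1_sig n) x) (mrunit_iso _).
have bj : bijective (fun h : hom (inv_serre Wla n) x =>
    fmap (W (proj1_sig n)) h ∘ Defs.unit (Wla n) one).
  exists (fun k => adjl (la_adj (Wla n)) k) => k.
    by apply: (unit_inj (L := Wla n)); rewrite unit_adjl.
  exact: (unit_adjl (Wla n)).
apply: (bij_inner _ (bij_precomp K i) (fun h => erefl)) => /=.
apply: (bij_comp_eq (bij_comp_eq (@Gev_perfect_l C one _) (Gmap_bij _ _)
  (fun _ => erefl)) bj) => h /=.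
rewrite -[LHS]/(point_pairing _) -inv_serre_evE !compA.
by rewrite -(compA _ (ihom_pre h _)) dcohom_ihom_pre !compA.
Qed.

Lemma inv_serre_ev_pairing (n : Mhat_odot W) : serre_pairing (inv_serre_ev n).
Proof.
apply: serre_pairing_of_right (@inv_serre_ev_right n).
by apply/(icohom_strongP W); case: (proj2_sig n).
Qed.

Lemma inv_serre_ev_intertwines (n n' : Mhat_odot W) (f : hom n n') :
  intertwines (inv_serre_ev n) (inv_serre_ev n') (fmap (inv_serre Wla) f) f.
Proof.
have i := is_iso_comp
  (dcohom_ihom_iso W (proj1_sig n) (inv_serre Wla n')) (mrunit_iso _).
apply: (bij_inj (bij_precomp K i)); rewrite !compA.
rewrite -(compA _ (ihom_pre _ _)) dcohom_ihom_pre compA inv_serre_evE.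
rewrite -(compA _ (fmap _ _)) dcohom_ihom_post compA inv_serre_evE.
by rewrite [X in point_pairing X]inv_serre_map_unit.
Qed.

End SerreFunctors.

Theorem theorem5p7 (C : GVCategory) (M : GVModuleCategory C)
    (W : forall m : M, LeftAdjoint (coact_r m))
    (Yra : forall m : Mhat_otimes M, RightAdjoint (ihom (proj1_sig m)))
    (Wla : forall m : Mhat_odot W, LeftAdjoint (W (proj1_sig m))) :
  exists (HS : forall m : Mhat_otimes M, hat_odot W (serre Yra m))
         (HT : forall n : Mhat_odot W, hat_otimes (inv_serre Wla n)),
    is_equivalence (corestrict HS : Functor (Mhat_otimes M) (Mhat_odot W)) /\
    is_equivalence (corestrict HT : Functor (Mhat_odot W) (Mhat_otimes M)) /\
    quasi_inverse_pair (corestrict HS : Functor (Mhat_otimes M) (Mhat_odot W))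
                       (corestrict HT : Functor (Mhat_odot W) (Mhat_otimes M)).
Proof.
pose HS m := serre_pairing_hat_odot W (serre_ev_pairing Yra m).
pose HT n := serre_pairing_hat_otimes W (inv_serre_ev_pairing Wla n).
exists HS, HT.
pose S : Functor (Mhat_otimes M) (Mhat_odot W) := corestrict HS.
pose T : Functor (Mhat_odot W) (Mhat_otimes M) := corestrict HT.
(* The pairings of [T (S m)] and of [m] with [S m] are both right universal;
   the isomorphism is the map compatible with them and the identity of [S m]. *)
have TS : inhabited (NatIso (compF T S) (idF (Mhat_otimes M))).
  apply: (natiso_of_spec (F := compF T S) (H := idF (Mhat_otimes M))
    (P := fun m (f : @hom (Mhat_otimes M) (compF T S m) m) =>
    intertwines (inv_serre_ev Wla (S m)) (serre_ev Yra m) f (idm _))).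
    move=> m; apply: right_universal_iso; first exact: inv_serre_ev_right.
    exact: serre_pairing_right (serre_ev_pairing Yra m).
  move=> m m' h f g Ef Eg.
  apply: (right_universal_unique (@inv_serre_ev_right C M W Wla (S m))).
    exact: intertwines_comp (inv_serre_ev_intertwines Wla (fmap S h)) Eg.
  rewrite [idm _ ∘ _]comp1m -[fmap S h]compm1.
  exact: intertwines_comp Ef (serre_ev_intertwines Yra h).
(* Dually, [S (T n)] and [n] both represent [x |-> Hom(ihom(T n, x), K)]. *)
have ST : inhabited (NatIso (compF S T) (idF (Mhat_odot W))).
  apply: (natiso_of_spec (F := compF S T) (H := idF (Mhat_odot W))
    (P := fun n (f : @hom (Mhat_odot W) (compF S T n) n) =>
    intertwines (serre_ev Yra (T n)) (inv_serre_ev Wla n) (idm _) f)).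
    move=> n; apply: left_universal_iso; first exact: serre_ev_left.
    exact: serre_pairing_left (inv_serre_ev_pairing Wla n).
  move=> n n' h f g Ef Eg.
  apply: (left_universal_unique
    (serre_pairing_left (inv_serre_ev_pairing Wla n'))).
    exact: intertwines_comp (serre_ev_intertwines Yra (fmap T h)) Eg.
  rewrite [idm _ ∘ _]comp1m -[fmap T h]compm1.
  exact: intertwines_comp Ef (inv_serre_ev_intertwines Wla h).
case: (TS) (ST) => u [v]; split; last split.
- by constructor; exists T.
- by constructor; exists S.
- by split.
Qed.
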